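(* Let $(R,\mathfrak{m})$ be a finite commutative local ring with identity, with $m=|\mathfrak{m}|$ and residue field $R/\mathfrak{m}\simeq \mathbb{F}_q$. If $k\in\mathbb{N}$ satisfies $(k,|R|)=1$, then $$G_R(k)\simeq \Gamma(k,q)^{(m)}\simeq G_{\mathbb{F}_q}(k)\otimes \mathring{K}_m,$$ where $\Gamma(k,q)^{(m)}$ is the balanced blow-up of order $m$ of $\Gamma(k,q)$, whose independent sets (the sets $V_x$ replacing the vertices $x$ of $\Gamma(k,q)$) are all the cosets of $\mathfrak{m}$ in $R$, and $\mathring{K}_m$ is the complete graph on $m$ vertices with a loop added at every vertex. In particular, $G_R(k)$ is $\frac{m(q-1)}{(k,q-1)}$-regular.
   Context: $(a,b)$ denotes the greatest common divisor. For a finite abelian group $G$ and $S\subset G$, $Cay(G,S)$ is the directed graph with vertex set $G$ and an arc from $v$ to $w$ iff $w-v\in S$; if $S=-S$ it is regarded as undirected. For a commutative ring $R$ with identity with unit group $R^*$, $G_R(k)=Cay(R,U_R(k))$ with $U_R(k)=\{x^k:x\in R^*\}$; and $\Gamma(k,q)=G_{\mathbb{F}_q}(k)=Cay(\mathbb{F}_q,\{x^k:x\in\mathbb{F}_q^*\})$. For a directed graph, $n$-regular means that every vertex has out-degree and in-degree $n$. The Kronecker product $\Gamma_1\otimes\Gamma_2$ has vertex set $V(\Gamma_1)\times V(\Gamma_2)$, with an edge (arc) from $(v_1,v_2)$ to $(w_1,w_2)$ iff there is an edge (arc) from $v_i$ to $w_i$ in $\Gamma_i$ for $i=1,2$ (loops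 allowed). The balanced blow-up $G^{(t)}$ of order $t$ of a graph $G$ is obtained by replacing each vertex $x$ by a set $V_x$ of $t$ independent vertices and each edge (arc) from $x$ to $y$ by all edges (arcs) from the elements of $V_x$ to the elements of $V_y$. *)

(* Defs.v *)
From mathcomp Require Import all_boot all_algebra.

Set Implicit Arguments.
Unset Strict Implicit.
Unset Printing Implicit Defensive.

Import GRing.Theory.
Local Open Scope ring_scope.

(* A finite directed graph on T, loops allowed, is its arc relation [e : rel T];
   an undirected graph is a symmetric arc relation, each edge standing for the
   two opposite arcs. *)

Definition digraph_isomorphism (T1 T2 : finType) (e1 : rel T1) (e2 : rel T2)
    (f : T1 -> T2) : Prop :=
  bijective f /\ forall v w, e2 (f v) (f w) = e1 v w.

Definition digraph_isomorphic (T1 T2 : finType) (e1 : rel T1) (e2 : rel T2) :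
    Prop :=
  exists f : T1 -> T2, digraph_isomorphism e1 e2 f.

Definition regular_digraph (T : finType) (e : rel T) (n : nat) : Prop :=
  forall v, #|[set w | e v w]| = n /\ #|[set w | e w v]| = n.

Definition independent (T : finType) (e : rel T) (A : {set T}) : Prop :=
  {in A &, forall v w, ~~ e v w}.

Definition Cay (G : finZmodType) (S : {set G}) : rel G :=
  fun v w => w - v \in S.

Definition unit_powers (R : finComUnitRingType) (k : nat) : {set R} :=
  [set x ^+ k | x : R & x \is a GRing.unit].

Definition power_graph (R : finComUnitRingType) (k : nat) : rel R :=
  Cay (unit_powers R k).
Arguments power_graph : clear implicits.

Definition Gamma (F : finFieldType) (k : nat) : rel F :=
  power_graph F k.
Arguments Gamma : clear implicits.

Definition kronecker (T1 T2 : finType) (e1 : rel T1) (e2 : rel T2) :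
    rel (T1 * T2)%type :=
  fun v w => e1 v.1 w.1 && e2 v.2 w.2.

Definition complete_graph (n : nat) : rel 'I_n :=
  fun i j => i != j.
Arguments complete_graph : clear implicits.

Definition add_loops (T : finType) (e : rel T) : rel T :=
  fun v w => (v == w) || e v w.

(* The copies of the vertex x are the pairs (x, i) with i < t.  They form an
   independent set exactly when x carries no loop of e (if t > 0), so this is
   the usual blow-up for loopless e. *)
Definition blowup (T : finType) (e : rel T) (t : nat) : rel (T * 'I_t)%type :=
  fun u v => e u.1 v.1.
Arguments blowup {T} e t _ _.

Definition blowup_part (T : finType) (t : nat) (x : T) :
    {set (T * 'I_t)%type} :=
  [set u | u.1 == x].

(* Inhabitants of [idealr R] are proper ideals: the library's structure
   requires 1 \notin I. *)
Definition maximal_ideal (R : comNzRingType) (I : idealr R) : Prop :=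
  forall J : idealr R, {subset I <= J} -> J =i I.

Definition local_ring (R : comNzRingType) (M : idealr R) : Prop :=
  maximal_ideal M /\ forall J : idealr R, maximal_ideal J -> J =i M.

Definition ring_isomorphic (R S : nzRingType) : Prop :=
  exists phi : {rmorphism R -> S}, bijective phi.

Definition ideal_cosets (R : finComUnitRingType) (I : idealr R) :
    {set {set R}} :=
  [set [set x + y | y in I] | x : R].

(* Main.v *)
Require Import Defs.
From HB Require Import structures.
From mathcomp Require Import all_boot all_fingroup all_solvable all_algebra.

Set Implicit Arguments.
Unset Strict Implicit.
Unset Printing Implicit Defensive.

Import GRing.Theory.
Local Open Scope ring_scope.

(** Let pi : R -> F be the residue map, with kernel M.  Everything follows from
    one fact: a ring element is a k-th power of a unit of R if and only if its
    residue is a k-th power of a unit of F ([mem_unit_powers_lift]).  Hence the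
    arcs of the graph on R depend only on residues, so the graph is pulled back
    along pi from the graph on F; as all fibres of pi (the cosets of M) have m
    elements, choosing a section of pi and an enumeration of M identifies R
    with F * 'I_m over F ([additive_surjection_trivial]), and this bijection is
    the isomorphism with the blow-up.

    The fact on k-th powers has two ingredients.  Since R is local, its
    nonunits all lie in M ([nonunit_in_local]), so pi reflects units.  Then, if
    pi x = (pi y) ^ k with pi y a unit, x and y are units and x / y ^ k lies in
    the kernel 1 + M of the map induced on unit groups.  This group has order
    #|M|, which divides #|R| and is therefore prime to k; so x / y ^ k is a
    k-th power in it, and x is a k-th power of a unit.

    For the blow-up and the Kronecker product with the complete graph with
    loops, the two arc relations coincide: that factor imposes no
    condition.  Finally both degrees of a Cayley graph are the size of its
    connection set, here m times the number of k-th powers in the cyclic group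
    of units of F. *)

(** * Ideals and nonunits of a local ring *)

(** Finite sets can be maximized, unlike inhabitants of [idealr R], which carry
    proofs; this predicate transports the search for a maximal ideal to
    sets. *)
Definition ideal_set (R : finNzRingType) (A : {set R}) : bool :=
  [&& 0 \in A, 1 \notin A
    & [forall a, forall u in A, forall v in A, a * u + v \in A]].

Lemma ideal_setP (R : finNzRingType) (A : {set R}) :
  reflect (idealr_closed A) (ideal_set A).
Proof.
apply: (iffP and3P) => [[A0 A1 Alin]|[A0 A1 Alin]]; split=> //.
  move=> a u v Au Av.
  by move/forallP/(_ a)/forall_inP/(_ u Au)/forall_inP/(_ v Av): Alin.
apply/forallP=> a; apply/forall_inP=> u Au; apply/forall_inP=> v Av.
exact: Alin.
Qed.

Lemma idealr_of_set (R : finNzRingType) (A : {set R}) :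
  ideal_set A -> exists J : idealr R, J =i A.
Proof.
move/ideal_setP=> A_ideal.
pose P : {pred R} := mem A.
have P_ideal : idealr_closed P by [].
exists (HB.pack_for (idealr R) P (isIdealr.Build R P P_ideal)).
by [].
Qed.

Lemma ideal_set_of_idealr (R : finNzRingType) (J : idealr R) :
  ideal_set [set x | x \in J].
Proof.
apply/ideal_setP; split; first by rewrite inE idealr0.
  by rewrite inE idealr1.
by move=> a u v; rewrite !inE => Ju Jv; rewrite rpredD ?idealMr.
Qed.

(** A nonunit x generates a proper ideal, which lies in a maximal one by
    finiteness; in a local ring the only candidate is M. *)
Lemma nonunit_in_local (R : finComUnitRingType) (M : idealr R) (x : R) :
  local_ring M -> x \isn't a GRing.unit -> x \in M.
Proof.
move=> [_ M_uniq] x_nonunit.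
have xR_ideal : ideal_set [set a * x | a : R].
  apply/ideal_setP; split.
  - by apply/imsetP; exists 0; rewrite ?mul0r.
  - apply: contra x_nonunit => /imsetP[a _ ax1].
    by apply/unitrPr; exists a; rewrite mulrC -ax1.
  - move=> a u v /imsetP[b _ ->] /imsetP[c _ ->].
    by apply/imsetP; exists (a * b + c); rewrite // mulrDl mulrA.
have [A /maxsetP[A_ideal A_max] sxRA] := maxset_exists xR_ideal.
have [J eqJ] := idealr_of_set A_ideal.
rewrite -(M_uniq J) => [|I sJI].
  rewrite eqJ (subsetP sxRA) //.
  by apply/imsetP; exists 1; rewrite ?mul1r.
have eqI := A_max _ (ideal_set_of_idealr I) _.
move=> y; rewrite eqJ -[in RHS]eqI ?inE //.
by apply/subsetP=> z Az; rewrite inE sJI ?eqJ.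
Qed.

(** * The residue map and its trivialization *)

Lemma residue_map (R : comNzRingType) (M : idealr R) (F : nzRingType) :
  ring_isomorphic {ideal_quot M} F ->
  exists pi : {rmorphism R -> F},
    (forall y, exists x, pi x = y) /\ (forall x, (pi x == 0) = (x \in M)).
Proof.
move=> [phi phi_bij].
pose p : {rmorphism R -> {ideal_quot M}} := \pi_{ideal_quot M}%qT.
exists (phi \o p : {rmorphism R -> F}).
have [psi phiK psiK] := phi_bij; split=> [y|x] /=.
  exists (generic_quotient.repr (psi y)); rewrite /= -[RHS]psiK; congr (phi _).
  exact: generic_quotient.reprK.
rewrite -(rmorph0 phi) (inj_eq (bij_inj phi_bij)).
rewrite -(rmorph0 p) -[in RHS](subr0 x) /p.
by rewrite Quotient.idealrBE.
Qed.

(** A set-theoretic section s of pi writes each x as s (pi x) plus an element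
    of the kernel; enumerating the kernel yields the second coordinate. *)
Lemma additive_surjection_trivial (G H : finZmodType) (pi : {additive G -> H}) (m : nat) :
    (forall y, exists x, pi x = y) -> #|[set x | pi x == 0]| = m ->
  exists2 f : G -> H * 'I_m, bijective f & forall x, (f x).1 = pi x.
Proof.
move=> pi_surj <-; set K := [set x | pi x == 0].
have pi_surjb y : exists x, pi x == y.
  by have [x <-] := pi_surj y; exists x.
pose s y := xchoose (pi_surjb y).
have sK y : pi (s y) = y by apply/eqP/(xchooseP (pi_surjb y)).
have K0 : 0 \in K by rewrite inE raddf0.
have Ks x : x - s (pi x) \in K by rewrite inE raddfB sK subrr.
exists (fun x => (pi x, enum_rank_in K0 (x - s (pi x)))) => //.
exists (fun u => s u.1 + enum_val u.2) => [x|[y i]] /=.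
  by rewrite enum_rankK_in // addrC subrK.
have := enum_valP i; rewrite inE => /eqP pi0.
by rewrite raddfD sK pi0 addr0 [s y + _]addrC addrK enum_valK_in.
Qed.

Lemma card_preimset_trivial (T S : finType) (m : nat) (f : T -> S * 'I_m)
    (A : {set S}) :
  bijective f -> #|[set x | (f x).1 \in A]| = (m * #|A|)%N.
Proof.
move=> f_bij.
have -> : [set x | (f x).1 \in A] = f @^-1: setX A setT.
  by apply/setP=> x; rewrite !inE andbT.
rewrite on_card_preimset; last exact: onW_bij.
by rewrite cardsX cardsT card_ord mulnC.
Qed.

(** * Powers of units *)

(** The map u |-> u - 1 is a bijection between the two kernels: 1 + x is a unit
    when pi x = 0, because pi reflects units. *)
Lemma card_unit_kernel (R S : finComUnitRingType) (pi : {rmorphism R -> S}) :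
    (forall x, pi x \is a GRing.unit -> x \is a GRing.unit) ->
  #|[set u : {unit R} | pi (val u) == 1]| = #|[set x | pi x == 0]|.
Proof.
move=> pi_local; set U := [set u : {unit R} | _].
have sub1_inj : injective (fun u : {unit R} => val u - 1).
  by move=> u v /addIr/val_inj.
rewrite -(card_imset U sub1_inj); apply: eq_card => x; rewrite !inE.
apply/imsetP/idP => [[u] | /eqP pix0].
  by rewrite inE => /eqP piu1 ->; rewrite rmorphB piu1 rmorph1 subrr.
have pi1x : pi (1 + x) = 1 by rewrite rmorphD rmorph1 pix0 addr0.
have unit1x : 1 + x \is a GRing.unit by apply: pi_local; rewrite pi1x unitr1.
exists (FinRing.unit R unit1x); first by rewrite inE /= pi1x.
by rewrite /= addrC addKr.
Qed.

Lemma unit_kernel_group_set (R S : finComUnitRingType)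
    (pi : {rmorphism R -> S}) :
  group_set [set u : {unit R} | pi (val u) == 1].
Proof.
apply/group_setP; split=> [|u v]; first by rewrite inE /= rmorph1.
by rewrite !inE FinRing.val_unitM rmorphM => /eqP-> /eqP->; rewrite mulr1.
Qed.

(** The obstruction to lifting a k-th power through pi lies in the kernel of
    the map on unit groups, whose order is prime to k, so that k-th powers
    exhaust it. *)
Lemma mem_unit_powers_lift (R S : finComUnitRingType)
    (pi : {rmorphism R -> S}) (k : nat) (x : R) :
    (forall y, exists x, pi x = y) ->
    (forall x, pi x \is a GRing.unit -> x \is a GRing.unit) ->
    coprime k #|R| ->
  (x \in unit_powers R k) = (pi x \in unit_powers S k).
Proof.
move=> pi_surj pi_local co_kR.
apply/imsetP/imsetP => [[y /[!inE] Uy ->]|[z /[!inE] Uz]].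
  by exists (pi y); rewrite ?rmorphXn ?inE ?rmorph_unit.
have [y piy] := pi_surj z; rewrite -{z}piy in Uz * => pix.
have Uy : y \is a GRing.unit by apply: pi_local.
have Ux : x \is a GRing.unit by apply: pi_local; rewrite pix unitrX.
pose K := Group (unit_kernel_group_set pi).
have co_Kk : coprime #|K| k.
  (* The order of K is that of the additive kernel, which divides #|R|. *)
  rewrite /= card_unit_kernel //.
  have [f f_bij _] := additive_surjection_trivial pi_surj erefl.
  move: co_kR; rewrite (bij_eq_card f_bij) card_prod card_ord.
  by rewrite coprimeMr coprime_sym [X in _ && X]coprime_sym => /andP[].
pose u := FinRing.unit R Uy; pose w := FinRing.unit R Ux.
pose v := ((u ^+ k)^-1 * w)%g.
have xE : x = y ^+ k * val v.
  rewrite -[x]/(val w) -(mulKVg (u ^+ k)%g w).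
  by rewrite FinRing.val_unitM FinRing.val_unitX.
have Kv : v \in K.
  rewrite inE -(inj_eq (mulrI (unitrX k Uz))) mulr1 -{2}pix xE.
  by rewrite rmorphM rmorphXn.
(* [expg_invn K k] is an inverse of k modulo the order of the group K. *)
exists (y * val (v ^+ expg_invn K k)%g).
  by rewrite inE unitrM Uy; exact: (valP _).
rewrite exprMn -FinRing.val_unitX -expgM mulnC expgM.
by rewrite [(_ ^+ expg_invn K k)%g]expgK.
Qed.

(** If g generates the cyclic group of units, its k-th powers are the elements
    of the subgroup generated by g ^ k. *)
Lemma card_unit_powers_field (F : finFieldType) (k : nat) :
  #|unit_powers F k| = ((#|F| - 1) %/ gcdn k (#|F| - 1))%N.
Proof.
have /cyclicP[g genF] := field_unit_group_cyclic [group of [set: {unit F}]].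
have <- : #[g]%g = (#|F| - 1)%N.
  by rewrite orderE -genF card_finField_unit subn1.
rewrite gcdnC -orderXgcd orderE -(card_imset _ (@val_inj _ _ {unit F})).
apply: eq_card => x; apply/imsetP/imsetP => [[y /[!inE] Uy ->]|[u gku ->]].
  have /cycleP[i ui] : FinRing.unit F Uy \in <[g]>%g by rewrite -genF inE.
  exists (FinRing.unit F Uy ^+ k)%g; last by rewrite FinRing.val_unitX.
  by rewrite ui -expgM mulnC expgM mem_cycle.
have /cycleP[i ->] := gku.
exists (val (g ^+ i)%g); first by rewrite inE; exact: (valP _).
by rewrite -FinRing.val_unitX -!expgM mulnC.
Qed.

(** * The graphs *)

Lemma card_out_neighbours_Cay (G : finZmodType) (S : {set G}) (v : G) :
  #|[set w | Cay S v w]| = #|S|.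
Proof.
rewrite -(@card_preimset _ (fun w => w - v) S); last exact: addIr.
by apply: eq_card => w; rewrite !inE.
Qed.

Lemma card_in_neighbours_Cay (G : finZmodType) (S : {set G}) (v : G) :
  #|[set w | Cay S w v]| = #|S|.
Proof.
rewrite -(@card_preimset _ (fun w => v - w) S) => [|w w' /addrI/oppr_inj//].
by apply: eq_card => w; rewrite !inE.
Qed.

Theorem theorem2p3 (R : finComUnitRingType) (M : idealr R) (F : finFieldType)
    (m q k : nat)
    (R_local : local_ring M)
    (card_M : #|M| = m)
    (residue_field : ring_isomorphic {ideal_quot M} F)
    (card_F : #|F| = q)
    (coprime_k : coprime k #|R|) :
  [/\ exists f : R -> F * 'I_m,
        [/\ digraph_isomorphism (power_graph R k) (blowup (Gamma F k) m) f,
            [set f @^-1: blowup_part m x | x : F] = ideal_cosets M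
          & forall C, C \in ideal_cosets M -> independent (power_graph R k) C],
      digraph_isomorphic (blowup (Gamma F k) m)
        (kronecker (power_graph F k) (add_loops (complete_graph m)))
    & regular_digraph (power_graph R k) ((m * (q - 1)) %/ gcdn k (q - 1))%N].
Proof.
have [pi [pi_surj pi_ker]] := residue_map residue_field.
have card_ker : #|[set x | pi x == 0]| = m.
  by rewrite -card_M; apply: eq_card => x; rewrite inE pi_ker.
have pi_local x : pi x \is a GRing.unit -> x \is a GRing.unit.
  rewrite unitfE pi_ker; apply: contraR; exact: nonunit_in_local.
have pi_powers x := mem_unit_powers_lift x pi_surj pi_local coprime_k.
have [f f_bij f_pi] := additive_surjection_trivial pi_surj card_ker.
have coset_fibre x : [set x + y | y in M] = [set w | pi w == pi x].
  apply/setP=> w; rewrite inE -subr_eq0 -rmorphB pi_ker.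
  apply/imsetP/idP => [[y My ->]|Mwx]; first by rewrite addrC addKr.
  by exists (w - x); rewrite // addrC subrK.
have part_fibre y : f @^-1: blowup_part m y = [set w | pi w == y].
  by apply/setP=> w; rewrite !inE f_pi.
split.
- exists f; split.
  + split=> // v w.
    by rewrite /blowup /Gamma /power_graph /Cay !f_pi pi_powers rmorphB.
  + apply/setP=> C; apply/imsetP/imsetP => -[x _ ->].
      have [w <-] := pi_surj x.
      by exists w; rewrite ?part_fibre ?coset_fibre.
    by exists (pi x); rewrite ?part_fibre ?coset_fibre.
  + move=> _ /imsetP[x _ ->] v w; rewrite coset_fibre !inE => /eqP piv /eqP piw.
    rewrite /power_graph /Cay pi_powers rmorphB piv piw subrr.
    apply/imsetP=> -[z]; rewrite inE => Uz z0.
    by have := unitrX k Uz; rewrite -z0 unitr0.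
- exists id; split=> [|v w]; first by exists id.
  by rewrite /kronecker /add_loops /complete_graph /blowup orbN andbT.
- have card_powers : #|unit_powers R k| = ((m * (q - 1)) %/ gcdn k (q - 1))%N.
    rewrite -muln_divA ?dvdn_gcdr // -card_F -card_unit_powers_field.
    rewrite -(card_preimset_trivial _ f_bij).
    by apply: eq_card => x; rewrite inE f_pi pi_powers.
  by move=> v; rewrite card_out_neighbours_Cay card_in_neighbours_Cay.
Qed.
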